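(* Assume $\omega_1^{<\omega_1}=\omega_1$, and let $\mathbb{L}_{\omega_1}$ be a $<\omega_1$-closed version of Laver forcing at $\omega_1$ with fusion. Let $\Gamma$ be a topologically reasonable family of subsets of $\omega_1$-reals, i.e. $\Gamma$ is closed under continuous pre-images and intersections with closed sets. Then $\Gamma(\mathbb{L}_{\omega_1})$ implies $\Gamma(\mathrm{Baire})$, that is, if every set in $\Gamma$ is $\mathbb{L}_{\omega_1}$-measurable then every set in $\Gamma$ has the Baire property. As a corollary, there is a $\mathbf{\Sigma}^1_1$ set which is not $\mathbb{L}_{\omega_1}$-measurable.
   Context: Put $\kappa=\omega_1$. $\kappa$-reals are elements of $\lambda^\kappa$ ($\lambda=2$ or $\lambda=\kappa$), with the topology generated by the sets $[s]=\{x\in\lambda^\kappa:s\subset x\}$, $s\in\lambda^{<\kappa}$. A set is $\mathbf{\Sigma}^1_1$ if it is the projection of a closed subset of $\lambda^\kappa\times\kappa^\kappa$ to $\lambda^\kappa$. A tree $T\subseteq\lambda^{<\kappa}$ is a subset closed under initial segments; trees are assumed $<\kappa$-closed, i.e. the union of every $\subseteq$-increasing sequence of length $<\kappa$ of nodes of $T$ is in $T$. $\mathrm{stem}(T)$ is the longest node of $T$ compatible with every node of $T$; $\mathrm{succ}(t,T)=\{\alpha\in\lambda: t^\frown\alpha\in T\}$; $[T]=\{x\in\lambda^\kappa:\forall\alpha<\kappa\,(x{\upharpoonright}\alpha\in T)\}$. Laver forcing at $\omega_1$. A version of Laver forcing at $\omega_1$ is given by a family $\mathcal{F}\subseteq[\omega_1]^{\omega_1}$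 (the requirement imposed at splitting nodes, e.g. all sets of size $\omega_1$ or all clubs): conditions are the trees $T\subseteq\omega_1^{<\omega_1}$ such that $\mathrm{succ}(t,T)\in\mathcal{F}$ for every $t\in T$ with $t\supseteq\mathrm{stem}(T)$, ordered by inclusion. It is required to be $<\omega_1$-closed (every decreasing sequence of conditions of countable length has a lower bound) and to have fusion, i.e. there are partial orders $\{\le_\alpha:\alpha<\omega_1\}$ on it with $\le_0=\le$, $\le_\beta\subseteq\le_\alpha$ for $\alpha<\beta$, and such that whenever $p_\beta\le_\alpha p_\alpha$ for all $\alpha<\beta<\omega_1$ there is $q$ with $q\le_\alpha p_\alpha$ for all $\alpha<\omega_1$. Tree-measurability. For a forcing $\mathbb{P}$ consisting of trees and a set $X$ of $\kappa$-reals: $X$ is $\mathbb{P}$-open dense iff $\forall T\in\mathbb{P}\,\exists T'\le T\,([T']\subseteq X)$; the complement of a $\mathbb{P}$-open dense set is $\mathbb{P}$-nowhere dense; $X$ is $\mathbb{P}$-meager if it is covered by a union of at most $\kappa$ many $\mathbb{P}$-nowhere dense sets; $\mathcal{I}_{\mathbb{P}}$ is the ideal of $\mathbb{P}$-meager sets. $X$ is $\mathbb{P}$-measurable iff for every $T\in\mathbb{P}$ there is $T'\le T$ such that $[T']\cap X\in\mathcal{I}_{\mathbb{P}}$ or $[T']\setminus X\in\mathcal{I}_{\mathbb{P}}$. The Baire property is $\mathbb{C}_\kappa$-measurability, where $\mathbb{C}_\kappa=(2^{<\kappa},\supseteq)$ is $\kappa$-Cohen forcing, with $s\in2^{<\kappa}$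 identified with the tree of nodes compatible with $s$ (set of branches $[s]$). $\Gamma(\mathbb{P})$ means that every set in $\Gamma$ is $\mathbb{P}$-measurable, and $\Gamma(\mathrm{Baire})$ that every set in $\Gamma$ has the Baire property. *)

(* Defs.v *)
From HB Require Import structures.
From mathcomp Require Import all_boot all_order.
From mathcomp Require Import boolp classical_sets functions wochoice cardinality.
From mathcomp Require Import topology.

Set Implicit Arguments.
Unset Strict Implicit.
Unset Printing Implicit Defensive.

Import Order.TTheory.
Local Open Scope order_scope.
Local Open Scope classical_set_scope.
Local Open Scope card_scope.

(* These properties determine W up to order isomorphism. Elements of W play
   the role of the countable ordinals, and W itself that of the set omega_1. *)
Record is_omega1 (d : Order.disp_t) (W : orderType d) : Prop := IsOmega1 {
  omega1_wo : well_order (@Order.le d W);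
  omega1_uncountable : ~ countable [set: W];
  omega1_segments : forall a : W, countable [set b : W | b < a] }.

(* L^{<kappa}: a sequence of length [len] in L, coded as the partial function
   that is defined exactly on the ordinals below [len]. *)
Record node (d : Order.disp_t) (W : orderType d) (L : Type) := Node {
  len : W;
  node_fun :> W -> option L;
  node_domE : forall b : W, isSome (node_fun b) = (b < len) }.

(* L^kappa. This is an alias of the function type, so that it does not carry
   the topology of pointwise convergence. *)
Definition kreal (d : Order.disp_t) (W : orderType d) (L : Type) : Type :=
  W -> L.

Section Reals.
Context (d : Order.disp_t) (W : orderType d) (L : Type).
Local Notation node := (node W L).
Local Notation kreal := (kreal W L).

Definition sub_node (s t : node) : Prop :=
  forall (b : W) (v : L), s b = Some v -> t b = Some v.

Definition compatible (s t : node) : Prop := sub_node s t \/ sub_node t s.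

Lemma restrict_domE (x : kreal) (a b : W) :
  isSome (if b < a then Some (x b) else None) = (b < a).
Proof. by case: ifP. Qed.

Definition restrict (x : kreal) (a : W) : node := Node (restrict_domE x a).

Definition basic_open (s : node) : set kreal :=
  [set x | forall (b : W) (v : L), s b = Some v -> x b = v].

(* u is t followed by the single letter v; the first clause says that len u
   is the successor of len t. *)
Definition is_snoc (t : node) (v : L) (u : node) : Prop :=
  [/\ forall b : W, (b < len u) = (b <= len t),
      sub_node t u & u (len t) = Some v].

(* The sequence s is only used below a, i.e. it has length a. For the least a the
   second clause says that a tree contains the empty sequence. *)
Definition is_tree (T : set node) : Prop :=
  (forall s t : node, sub_node s t -> T t -> T s) /\
  (forall (a : W) (s : W -> node) (u : node),
     (forall b : W, b < a -> T (s b)) ->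
     (forall b c : W, b <= c -> c < a -> sub_node (s b) (s c)) ->
     (forall (i : W) (v : L),
        u i = Some v <-> exists2 b : W, b < a & s b i = Some v) ->
     T u).

Definition is_stem (T : set node) (s : node) : Prop :=
  [/\ T s, forall t : node, T t -> compatible s t
    & forall s' : node, T s' -> (forall t : node, T t -> compatible s' t) ->
        len s' <= len s].

Definition succ (t : node) (T : set node) : set L :=
  [set v | exists2 u : node, T u & is_snoc t v u].

Definition branches (T : set node) : set kreal :=
  [set x | forall a : W, T (restrict x a)].

(* In the next definitions, P is a set of trees, viewed as a forcing notion
   ordered by inclusion. *)
Definition lt_omega1_closed (P : set (set node)) : Prop :=
  forall (a : W) (p : W -> set node),
    (forall b : W, b < a -> P (p b)) ->
    (forall b c : W, b <= c -> c < a -> p c `<=` p b) ->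
    exists2 q : set node, P q & forall b : W, b < a -> q `<=` p b.

(* le a q p is read q <=_a p. *)
Definition has_fusion (P : set (set node)) : Prop :=
  exists le : W -> set node -> set node -> Prop,
    [/\ forall a : W,
          [/\ forall p, P p -> le a p p,
              forall p q, P p -> P q -> le a p q -> le a q p -> p = q
            & forall p q r, P p -> P q -> P r ->
                le a p q -> le a q r -> le a p r],
        forall a : W, (forall b : W, a <= b) ->
          forall p q, P p -> P q -> (le a q p <-> q `<=` p),
        forall a b : W, a < b ->
          forall p q, P p -> P q -> le b q p -> le a q p
      & forall p : W -> set node,
          (forall a : W, P (p a)) ->
          (forall a b : W, a < b -> le a (p b) (p a)) ->
          exists2 q : set node, P q & forall a : W, le a q (p a)].

Definition P_open_dense (P : set (set node)) (X : set kreal) : Prop :=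
  forall T, P T -> exists T', [/\ P T', T' `<=` T & branches T' `<=` X].

Definition P_nowhere_dense (P : set (set node)) (X : set kreal) : Prop :=
  P_open_dense P (~` X).

Definition P_meager (P : set (set node)) (X : set kreal) : Prop :=
  exists N : set (set kreal),
    [/\ N #<= [set: W], forall A, N A -> P_nowhere_dense P A
      & X `<=` \bigcup_(A in N) A].

Definition P_measurable (P : set (set node)) (X : set kreal) : Prop :=
  forall T, P T -> exists T',
    [/\ P T', T' `<=` T
      & P_meager P (branches T' `&` X) \/ P_meager P (branches T' `\` X)].

End Reals.

HB.instance Definition _ (d : Order.disp_t) (W : orderType d) (L : Type) :=
  gen_eqMixin (kreal W L).
HB.instance Definition _ (d : Order.disp_t) (W : orderType d) (L : Type) :=
  gen_choiceMixin (kreal W L).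
HB.instance Definition _ (d : Order.disp_t) (W : orderType d) (L : Type) :=
  @isSubBaseTopological.Build (kreal W L) (set (kreal W L))
    (range (@basic_open d W L)) id.

Section Forcings.
Context (d : Order.disp_t) (W : orderType d).

Definition laver (F : set (set W)) : set (set (node W W)) :=
  [set T | is_tree T /\
     exists2 s, is_stem T s &
       forall t, T t -> sub_node s t -> F (succ t T)].

(* The decreasing sequences in lt_omega1_closed may have length 0; hence the
   closure condition implies that the forcing (and so F) is nonempty. *)
Definition laver_version (F : set (set W)) : Prop :=
  [/\ forall A, F A -> A #= [set: W],
      lt_omega1_closed (laver F) & has_fusion (laver F)].

Definition cohen : set (set (node W bool)) :=
  [set T | exists s, T = [set t | compatible s t]].

Definition baire_property (X : set (kreal W bool)) : Prop :=
  P_measurable cohen X.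

Definition closed_under_preimages (X Y : topologicalType)
    (GX : set (set X)) (GY : set (set Y)) : Prop :=
  forall f : X -> Y, continuous f -> forall A, GY A -> GX (f @^-1` A).

Definition closed_under_closedI (X : topologicalType) (GX : set (set X)) :
    Prop :=
  forall A C, GX A -> closed C -> GX (A `&` C).

(* A family of sets of kappa-reals is given by its members G2 contained in
   2^kappa and its members Gk contained in kappa^kappa. *)
Definition topologically_reasonable
    (G2 : set (set (kreal W bool))) (Gk : set (set (kreal W W))) : Prop :=
  [/\ closed_under_preimages G2 G2, closed_under_preimages G2 Gk,
      closed_under_preimages Gk G2 & closed_under_preimages Gk Gk] /\
  (closed_under_closedI G2 /\ closed_under_closedI Gk).

Definition sigma11 (L : Type) (X : set (kreal W L)) : Prop :=
  exists2 C : set (kreal W L * kreal W W), closed C & X = fst @` C.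

End Forcings.

(* Main.v *)
Require Import Defs.
From mathcomp Require Import all_boot all_order finmap.
From mathcomp Require Import boolp classical_sets functions wochoice cardinality.
From mathcomp Require Import topology.

(* At a node of length a above the stem, choosing a branch of a Laver tree for
   omega more steps one can reach, as supremum of the chosen values, any element
   of some club.  Hence some 2-colouring of the omega-sequences (obtained from
   the digits of a real attached to the supremum) takes both values on the next
   block of length omega, in every Laver tree and after every node.  Colouring
   the successive blocks of x defines a continuous map f on the kappa-reals, and
   f maps the branches of a Laver tree with stem of length omega * g onto a basic
   open set.

   Countable closure of the forcing implies countable closure of F, so that
   a countable decreasing sequence of Laver trees has a lower bound whose stem is
   the union of the stems.  Therefore one can play the Banach-Mazur game of length
   omega_1 on both sides of f simultaneously: if f^-1(Y) is meager for the Laver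
   forcing below some tree, then Y is Cohen-meager in some basic open set.

   For the last assertion, the family of all Sigma^1_1 sets is topologically
   reasonable, and the club filter is a Sigma^1_1 set without the Baire
   property. *)

Set Implicit Arguments.
Unset Strict Implicit.
Unset Printing Implicit Defensive.

Import Order.TTheory.
Local Open Scope order_scope.
Local Open Scope classical_set_scope.
Local Open Scope card_scope.

(** * The ordinal omega_1 *)

Section Omega1.
Context (d : Order.disp_t) (W : orderType d) (W1 : is_omega1 W).
Implicit Types a b c : W.

Lemma min_exists (P : W -> Prop) :
  (exists a, P a) -> exists2 a, P a & forall b, P b -> a <= b.
Proof.
case=> a Pa; pose A := [pred b | `[< P b >]].
have /(omega1_wo W1)[m [[]]] : wochoice.nonempty A by exists a; exact: asboolT.
move=> Am minm _; exists m => [|b Pb]; first exact: asboolW Am.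
by apply: minm; exact: asboolT.
Qed.

Lemma lt_ind (P : W -> Prop) :
  (forall a, (forall b, b < a -> P b) -> P a) -> forall a, P a.
Proof.
move=> IH a; apply: contrapT => nPa.
have [m nPm minm] := @min_exists (fun a => ~ P a) (ex_intro _ a nPa).
apply: nPm; apply: IH => b ltbm; apply: contrapT => /minm.
by rewrite leNgt ltbm.
Qed.

Lemma lt_wf : well_founded (fun a b : W => is_true (a < b)).
Proof. by move=> a; elim/lt_ind: a => a IH; constructor. Qed.

(** [G] sees the earlier values only, since they are replaced by [v0] from [a] on; the recursion
    equation therefore holds for a total [h]. *)
Lemma wf_rec (A : Type) (v0 : A) (G : W -> (W -> A) -> A) :
  exists h : W -> A, forall a, h a = G a (fun b => if b < a then h b else v0).
Proof.
pose step a (h : forall b, b < a -> A) :=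
  G a (fun b => if pselect (b < a) is left lt_ba then h b lt_ba else v0).
exists (Fix lt_wf (fun=> A) step) => a; rewrite Fix_eq.
  rewrite /step; congr (G a _); apply/funext => b.
  by case: pselect => [->//|/negP/negbTE ->].
move=> {}a h h' hh'; rewrite /step; congr (G a _); apply/funext => b.
by case: pselect.
Qed.

(** This is dependent choice of length omega_1, the engine of the transfinite constructions below:
    [R a h v] depends on [h] below [a] only, and a next value is required only after a correct
    initial part. *)
Lemma wf_choice (A : Type) (v0 : A) (R : W -> (W -> A) -> A -> Prop) :
  (forall a h h' v, (forall b, b < a -> h b = h' b) -> R a h v -> R a h' v) ->
  (forall a h, (forall b, b < a -> R b h (h b)) -> exists v, R a h v) ->
  exists h, forall a, R a h (h a).
Proof.
move=> Rext Rex.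
have /choice[G GP] : forall ah : W * (W -> A), exists v,
    (forall b, b < ah.1 -> R b ah.2 (ah.2 b)) -> R ah.1 ah.2 v.
  move=> [a h] /=; have [H|nH] := pselect (forall b, b < a -> R b h (h b)).
    by have [v Rv] := Rex a h H; exists v.
  by exists v0.
have [h hE] := wf_rec v0 (fun a h => G (a, h)).
exists h => a; elim/lt_ind: a => a IH; rewrite hE.
set h' := fun b => _; have h'E b : b < a -> h b = h' b by rewrite /h' => ->.
apply: (Rext a h') => [b ba|]; first by rewrite h'E.
apply: (GP (a, h')) => b ba /=; rewrite -h'E//.
by apply: (Rext b h) (IH b ba) => c cb; rewrite h'E// (lt_trans cb).
Qed.

(** Regularity of omega_1: if the values were unbounded, [W] would be a countable union of countable
    closed segments. *)
Lemma countable_bounded (I : Type) (D : set I) (g : I -> W) :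
  countable D -> exists a, forall i, D i -> g i < a.
Proof.
move=> cD; apply: contrapT => /forallNP nb; apply: (omega1_uncountable W1).
have -> : [set: W] = \bigcup_(i in D) ([set b | b < g i] `|` [set g i]).
  apply/seteqP; split=> // a _; have /existsNP[i /not_implyP[Di]] := nb a.
  move=> /negP; rewrite -leNgt le_eqVlt => /orP[/eqP ->|lta]; exists i => //.
    by right.
  by left.
apply: bigcup_countable => // i _; rewrite -bigcup2E.
apply: bigcup_countable => // -[_|[_|_ _]] //=; first exact: omega1_segments.
Qed.

Lemma inhabited_omega1 : inhabited W.
Proof.
have [a _] := @countable_bounded False set0 (False_rect W) (countable0 _).
by constructor.
Qed.

(** The supremum is described through its upper bounds, so that an empty [D] is allowed and yields
    the least element. *)
Lemma seg_lub (A : Type) (D : set A) (g : A -> W) : countable D ->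
  exists v, forall a, v <= a <-> forall i, D i -> g i <= a.
Proof.
move=> cD; have [a ga] := countable_bounded g cD.
have [m gm minm] := @min_exists (fun a => forall i, D i -> g i <= a)
  (ex_intro _ a (fun i Di => ltW (ga i Di))).
by exists m => b; split=> [mb i Di|/minm//]; apply: le_trans (gm i Di) mb.
Qed.

Lemma unbounded_uncountable (A : set W) : A #= [set: W] ->
  forall a, exists2 b, A b & a < b.
Proof.
move=> AW a; apply: contrapT => nb; apply: (omega1_uncountable W1).
rewrite -(eq_countable AW); apply: (@sub_countable _ _ _ ([set b | b < a] `|` [set a])).
  apply: subset_card_le => b Ab /=.
  case: (ltgtP b a) => [ba|ab|->]; [by left| |by right].
  by case: nb; exists b.
rewrite -bigcup2E; apply: bigcup_countable => // -[_|[_|_ _]] //=.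
exact: omega1_segments.
Qed.

Lemma suc_exists : {s : W -> W & forall a b, (s a <= b) = (a < b)}.
Proof.
apply: (@choice W W (fun a v => forall b, (v <= b) = (a < b))) => a.
have [b /(_ tt I) ab] := @countable_bounded unit setT (fun=> a) (countableP _).
have [m am minm] := @min_exists (fun b => a < b) (ex_intro _ b ab).
exists m => c; apply/idP/idP => [|/minm//]; exact: lt_le_trans.
Qed.

Lemma lub_exists :
  {l : (nat -> W) -> W & forall g a, l g <= a <-> forall n, g n <= a}.
Proof.
apply: (@choice _ _ (fun g v => forall a, v <= a <-> forall n, g n <= a)) => g.
have [v vP] := @seg_lub nat setT g (countableP _).
by exists v => a; rewrite vP; split=> H // n; apply: H.
Qed.

(** A new real can be chosen at each stage: the earlier values are countable in number, so by Cantor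
    they do not exhaust the reals. *)
Lemma reals_inj : exists r : W -> nat -> bool, injective r.
Proof.
have [|a h _|r rP] := @wf_choice (nat -> bool) (fun=> true)
  (fun a h v => forall b, b < a -> h b <> v); last 1 first.
- exists r => a b rab; case: (ltgtP a b) => // ltab.
    by case: (rP b a ltab).
  by case: (rP a b ltab).
- by move=> a h h' v hh' Hv b ba; rewrite -hh'//; apply: Hv.
- apply: contrapT => /forallNP nv.
  have /countable_injP[f finj] := omega1_segments W1 a.
  have /choice[g gP] : forall v : nat -> bool, exists b, b < a /\ h b = v.
    move=> v; have /existsNP[b /not_implyP[ba /contrapT hb]] := nv v.
    by exists b.
  (* Cantor's diagonal argument for [f \o g : (nat -> bool) -> nat]. *)
  pose v n := ~~ `[< exists2 w, f (g w) = n & w n >].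
  have vE : v (f (g v)) = ~~ v (f (g v)).
    rewrite {1}/v; congr negb; apply/asboolP/idP => [[w fw]|]; last by exists v.
    have -> // : w = v.
    rewrite -(gP w).2 -(gP v).2; congr h; apply: finj => //;
      by rewrite inE /=; apply: (gP _).1.
  by case: (v _) vE.
Qed.


Definition suc : W -> W := projT1 suc_exists.
Definition lub : (nat -> W) -> W := projT1 lub_exists.
Definition add_omega a : W := lub (fun n => iter n suc a).

Lemma suc_le a b : (suc a <= b) = (a < b).
Proof. exact: (projT2 suc_exists a b). Qed.

Lemma lub_le g a : lub g <= a <-> forall n, g n <= a.
Proof. exact: (projT2 lub_exists g a). Qed.

Lemma le_lub g n : g n <= lub g.
Proof. by move: n; apply/lub_le. Qed.

Lemma lt_suc a : a < suc a.
Proof. by rewrite -suc_le. Qed.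

Lemma ltS a b : (a < suc b) = (a <= b).
Proof. by rewrite ltNge suc_le -leNgt. Qed.

Lemma lt_iter a n m : (n < m)%N -> iter n suc a < iter m suc a.
Proof.
elim: m => // m IH; rewrite ltnS leq_eqVlt => /orP[/eqP ->|/IH nm].
  exact: lt_suc.
exact: lt_trans nm (lt_suc _).
Qed.

Lemma iter_inj a : injective (fun n => iter n suc a).
Proof.
move=> n m E; case: (ltngtP n m) => // /(lt_iter a); first by rewrite /= E ltxx.
by rewrite E ltxx.
Qed.

Lemma iter_lt_add_omega a n : iter n suc a < add_omega a.
Proof. rewrite -suc_le; exact: (le_lub _ n.+1). Qed.

Lemma lt_add_omega a : a < add_omega a.
Proof. exact: (iter_lt_add_omega a 0). Qed.

Lemma lt_add_omegaP a b : b < add_omega a -> exists n, b < iter n suc a.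
Proof.
move=> ba; apply: contrapT => /forallNP nb; move: ba; rewrite ltNge => /negP; apply.
by apply/lub_le => n; rewrite leNgt; apply/negP/nb.
Qed.

Lemma lt_add_omega_iter a b : a <= b -> b < add_omega a -> exists n, b = iter n suc a.
Proof.
move=> ab /lt_add_omegaP[n]; elim: n => [|n IH]; first by rewrite ltNge ab.
by rewrite /= ltS le_eqVlt => /orP[/eqP ->|/IH//]; exists n.
Qed.

Lemma suc_lt_add_omega a b : b < add_omega a -> suc b < add_omega a.
Proof.
move=> /lt_add_omegaP[n]; rewrite -suc_le => /le_lt_trans; apply.
exact: iter_lt_add_omega.
Qed.

(* For each n consider the n-th digit of a real attached to the supremum of
   the sequence. If every digit failed on some family [G n] and colour [i n],
   then, building branches of all the [G n] with the same supremum [a], the real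
   attached to [a] would be [~~ i n], for unboundedly many [a]. *)
Lemma coloring : exists c : (nat -> W) -> bool, forall G : seq W -> set W,
  (forall q a, exists2 b, G q b & a < b) ->
  forall i, exists z, (forall n, G (mkseq z n) (z n)) /\ c z = i.
Proof.
have [r rinj] := reals_inj; apply: contrapT => /forallNP nc.
have /choice[Gi GiP] : forall n, exists Gi : (seq W -> set W) * bool,
    (forall q a, exists2 b, Gi.1 q b & a < b) /\
    forall z, (forall k, Gi.1 (mkseq z k) (z k)) -> r (lub z) n = ~~ Gi.2.
  move=> n; have /existsNP[G /not_implyP[Gu /existsNP[i /forallNP nz]]] :=
    nc (fun z => r (lub z) n).
  exists (G, i); split=> // z zG; have : r (lub z) n <> i.
    by move=> E; apply: (nz z).
  by rewrite /=; case: (r _ _) i {nz zG} => -[].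
have /choice[p pP] : forall nqa : nat * seq W * W, exists b,
    (Gi nqa.1.1).1 nqa.1.2 b /\ nqa.2 < b.
  by move=> [[n q] a]; have [b] := (GiP n).1 q a; exists b.
have /choice[B BP] : forall g : nat -> W, exists a, forall n, g n < a.
  move=> g; have [a aP] := @countable_bounded nat setT g (countableP _).
  by exists a => n; apply: aP.
(* All the sequences [z n] are built simultaneously: in round k each picks a value above the current
   bound, and [B] supplies the next bound above all of these values. Interleaving with the same
   bounds gives them the same supremum. *)
have sup_all a0 : exists2 a, a0 < a & forall n, r a n = ~~ (Gi n).2.
  pose step (s : (nat -> seq W) * W) :=
    (fun n => rcons (s.1 n) (p (n, s.1 n, s.2)), B (fun n => p (n, s.1 n, s.2))).
  pose s k := iter k step (fun=> [::], a0).
  pose z n k := p (n, (s k).1 n, (s k).2).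
  have zE n k : mkseq (z n) k = (s k).1 n.
    by elim: k => // k IH; rewrite mkseqS IH.
  have lub_z n : lub (z n) = lub (fun k => (s k).2).
    apply: le_anti; apply/andP; split; apply/lub_le => k.
      apply: le_trans (le_lub _ k.+1); apply: ltW.
      exact: (BP (fun n => p (n, (s k).1 n, (s k).2))).
    by apply: le_trans (le_lub _ k); apply: ltW; apply: (pP (n, _, _)).2.
  exists (lub (fun k => (s k).2)) => [|n].
    rewrite -(lub_z 0%N); apply: lt_le_trans (le_lub _ 0%N).
    exact: (pP (0%N, [::], a0)).2.
  rewrite -(lub_z n); apply: (GiP n).2 => k; rewrite zE.
  exact: (pP (n, (s k).1 n, (s k).2)).1.
have [w0] := inhabited_omega1.
have [a _ aP] := sup_all w0; have [b ab bP] := sup_all a.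
have : a = b by apply: rinj; apply/funext => n; rewrite aP bP.
by move=> E; rewrite E ltxx in ab.
Qed.

(** The function [e] is b |-> omega * b. One formula, the supremum of the earlier values plus omega,
    covers zero, successors and limits. *)
Lemma omega_mul_exists : exists e : W -> W,
  forall b a, e b <= a <-> forall c, c < b -> add_omega (e c) <= a.
Proof.
have [w0] := inhabited_omega1.
have [b h h' v hh' H a|b h _|e eP] := @wf_choice W w0
  (fun b h v => forall a, v <= a <-> forall c, c < b -> add_omega (h c) <= a).
- rewrite H; split=> K c cb; [rewrite -hh'//|rewrite hh'//]; exact: K.
- exact: (seg_lub _ (omega1_segments W1 b)).
- by exists e.
Qed.
End Omega1.

(** * Nodes and trees *)

Section Nodes.
Context (d : Order.disp_t) (W : orderType d) (W1 : is_omega1 W) (L : Type).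
Implicit Types (a b c : W) (x y : W -> L) (s t : node W L).
Local Notation suc := (suc W1).
Local Notation restrict := Defs.restrict.
Local Notation add_omega := (add_omega W1).

Definition agree a x y := forall c, c < a -> x c = y c.

Lemma agree_sym a x y : agree a x y -> agree a y x.
Proof. by move=> H c /H. Qed.

Lemma agree_trans a x y z : agree a x y -> agree a y z -> agree a x z.
Proof. by move=> H K c ca; rewrite H// K. Qed.

Lemma agree_le a b x y : a <= b -> agree b x y -> agree a x y.
Proof. by move=> ab H c ca; apply: H; apply: lt_le_trans ab. Qed.

Definition upd x a v : W -> L := fun b => if b == a then v else x b.

Lemma updE x a v : upd x a v a = v.
Proof. by rewrite /upd eqxx. Qed.

Lemma upd_agree x a v : agree a (upd x a v) x.
Proof. by move=> c ca; rewrite /upd lt_eqF. Qed.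

Lemma agree_suc a x y : agree (suc a) x y <-> agree a x y /\ x a = y a.
Proof.
split=> [H|[H E] c]; last by rewrite ltS le_eqVlt => /orP[/eqP ->//|/H].
by split=> [c ca|]; apply: H; rewrite ?lt_suc// (lt_trans ca)// lt_suc.
Qed.

Lemma node_eq s t : len s = len t -> node_fun s =1 node_fun t -> s = t.
Proof.
case: s t => [a f Hf] [b g Hg] /= ab /funext fg; subst g; subst b.
by congr Node; apply: Prop_irrelevance.
Qed.

Lemma restrict_eq x y a : restrict x a = restrict y a <-> agree a x y.
Proof.
split=> [E c ca|H]; last first.
  by apply: node_eq => //= c; case: ifP => // ca; rewrite H.
have : restrict x a c = restrict y a c by rewrite E.
by rewrite /= ca => -[].
Qed.

(** Every node is handled below as [restrict x a] with [x] total; the letter [v0] only fills the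
    places beyond its length. *)
Definition extend (v0 : L) t : W -> L := fun b => odflt v0 (t b).

Lemma restrict_extend v0 t : restrict (extend v0 t) (len t) = t.
Proof.
apply: node_eq => //= c; rewrite -node_domE /extend.
by case: (t c).
Qed.

Lemma sub_restrict x a y b :
  sub_node (restrict x a) (restrict y b) <-> a <= b /\ agree a x y.
Proof.
split=> [H|[ab H] c v /=].
  have K c : c < a -> (if c < b then Some (y c) else None) = Some (x c).
    by move=> ca; apply: H; rewrite /= ca.
  split=> [|c /K]; last by case: ifP => // _ [].
  by rewrite leNgt; apply/negP => /K; rewrite ltxx.
by case: ifP => // ca [<-]; rewrite (lt_le_trans ca ab) H.
Qed.

Lemma basic_open_restrict x y a : basic_open (restrict x a) y <-> agree a x y.
Proof.
split=> [H c ca|H c v /=]; first by apply/esym/H; rewrite /= ca.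
by case: ifP => // /H E [<-].
Qed.

Lemma compatible_restrict x a y b : a <= b ->
  (compatible (restrict x a) (restrict y b) <-> agree a x y).
Proof.
move=> ab; split=> [[|] /sub_restrict[] // ba H|H].
  by apply: agree_sym; rewrite (@le_anti _ _ a b) ?ab.
by left; apply/sub_restrict.
Qed.

Lemma tree_restrict T x a b :
  is_tree T -> a <= b -> T (restrict x b) -> T (restrict x a).
Proof. by move=> [+ _] ab; apply; apply/sub_restrict; split. Qed.

Lemma tree_agree (T : set (node W L)) x y a :
  agree a x y -> T (restrict x a) -> T (restrict y a).
Proof. by move=> /restrict_eq ->. Qed.

(** The closure clause of [is_tree] is applied to the restrictions to [suc b], b < a, whose union is
    [restrict x a] whether [a] is zero, a successor or a limit. *)
Lemma tree_limit T x a : is_tree T ->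
  (forall b, b < a -> T (restrict x (suc b))) -> T (restrict x a).
Proof.
move=> [_ cT] H; apply: (cT a (fun b => restrict x (suc b))) => //.
  move=> b c bc ca; apply/sub_restrict; split=> //.
  by rewrite suc_le ltS.
move=> i v /=; split=> [|[b ba]].
  by case: ifP => // ia [<-]; exists i; rewrite // lt_suc.
case: ifP => //; rewrite ltS => ib [<-].
by rewrite (le_lt_trans ib ba).
Qed.

Lemma tree_step T x a : is_tree T ->
  (forall b, b < a -> T (restrict x b) -> T (restrict x (suc b))) ->
  T (restrict x a).
Proof.
move=> tT; elim/(lt_ind W1): a => a IH H; apply: tree_limit => // b ba.
by apply: (H b ba); apply: IH => // c cb; apply: H; apply: lt_trans ba.
Qed.

Lemma snoc_restrict x a v u :
  is_snoc (restrict x a) v u <-> u = restrict (upd x a v) (suc a).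
Proof.
split=> [[lu su ua]|->]; last first.
  split=> [b||]; first by rewrite /= ltS.
    apply/sub_restrict; split; first exact/ltW/lt_suc.
    exact/agree_sym/upd_agree.
  by rewrite /= lt_suc updE.
rewrite -(restrict_extend v u) in su ua *.
have lenu : len u = suc a.
  by apply: le_anti; rewrite suc_le lu /= lexx andbT leNgt lu /= suc_le ltxx.
rewrite lenu in su ua *; move: ua su; rewrite /= lt_suc => -[ua].
move=> /sub_restrict[_ su]; apply/restrict_eq/agree_suc; rewrite updE; split=> //.
exact/agree_sym/(agree_trans _ su)/upd_agree.
Qed.

Lemma succP T x a v :
  succ (restrict x a) T v <-> T (restrict (upd x a v) (suc a)).
Proof.
split=> [[u Tu /snoc_restrict <-]//|H].
by exists (restrict (upd x a v) (suc a)) => //; apply/snoc_restrict.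
Qed.

(** This glues the approximations of a transfinite construction; [h b] matters only below [l b]. *)
Lemma coherent_union (v0 : L) (D : W -> Prop) (h : W -> W -> L) (l : W -> W) :
  (forall b c, D b -> D c -> b <= c -> agree (l b) (h b) (h c)) ->
  exists x, forall b, D b -> agree (l b) x (h b).
Proof.
move=> coh; have /choice[x xP] : forall c, exists v,
    forall b, D b -> c < l b -> v = h b c.
  move=> c; have [[b [Db cb]]|nb] := pselect (exists b, D b /\ c < l b); last first.
    by exists v0 => b Db cb; case: nb; exists b.
  exists (h b c) => b' Db' cb'.
  case: (leP b b') => [bb'|/ltW b'b]; first exact: coh.
  by apply/esym; apply: coh cb'.
by exists x => b Db c cb; apply: xP.
Qed.

(* [x] is any total extension of [t]; it is only used to form the initial
   segments of [t]. *)
Definition tree_of (C : node W L -> L -> Prop) : set (node W L) :=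
  [set t : node W L | forall b v, t b = Some v ->
     forall x, t = restrict x (len t) -> C (restrict x b) v].

Lemma tree_ofP C x a :
  tree_of C (restrict x a) <-> forall b, b < a -> C (restrict x b) (x b).
Proof.
split=> [H b ba|H b v /=]; first by apply: H => //=; rewrite ba.
case: ifP => // ba [<-] y /restrict_eq xy.
have -> : restrict y b = restrict x b.
  by apply/restrict_eq => c cb; rewrite xy// (lt_trans cb).
exact: H.
Qed.

Lemma is_tree_tree_of C : is_tree (tree_of C).
Proof.
(* Over an empty alphabet no total extension exists, but all nodes are nowhere defined and the
   condition of [tree_of] is vacuous. *)
have [v0|nL] := pselect (exists v : L, True); last first.
  have W0 (t : node W L) b : t b = None by case: (t b) => // v; case: nL; exists v.
  by split=> [s t _ _|a s u _ _ _] b v; rewrite W0.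
case: v0 => v0 _; split=> [s t|a s u sC coh uE].
  rewrite -(restrict_extend v0 s) -(restrict_extend v0 t).
  move=> /sub_restrict[st stE] /tree_ofP H; apply/tree_ofP => b bs.
  have /restrict_eq -> : agree b (extend v0 s) (extend v0 t).
    exact: agree_le (ltW bs) stE.
  by rewrite stE//; apply/H/(lt_le_trans bs).
rewrite -(restrict_extend v0 u); apply/tree_ofP => b; rewrite -node_domE => bu.
have [v uv] : exists v, u b = Some v by case: (u b) bu => // v _; exists v.
have /uE[c ca sc] := uv; have := sC c ca.
have scu : sub_node (s c) u by move=> i w siw; apply/uE; exists c.
rewrite -(restrict_extend v0 (s c)) => /tree_ofP.
have bc : b < len (s c) by rewrite -node_domE sc.
move=> /(_ b bc); rewrite -(restrict_extend v0 (s c)) -(restrict_extend v0 u) in scu.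
move/sub_restrict: scu => [_ su]; rewrite su//.
by have /restrict_eq -> : agree b (extend v0 (s c)) (extend v0 u) by
  exact: agree_le (ltW bc) su.
Qed.

End Nodes.

(** * Laver trees *)

Section Laver.
Context (d : Order.disp_t) (W : orderType d) (W1 : is_omega1 W).
Context (F : set (set W)).
Implicit Types (a b c l : W) (x y : W -> W) (T : set (node W W)).
Local Notation suc := (suc W1).
Local Notation restrict := Defs.restrict.

(* [T] is a Laver tree with stem [restrict x l]. *)
Definition laver_at T x l := [/\ is_tree T, T (restrict x l),
  forall y a c, T (restrict y a) -> c < a -> c < l -> y c = x c
  & forall y a, T (restrict y a) -> l <= a -> F (succ (restrict y a) T)].

Lemma laver_at_laver T x l :
  (forall A, F A -> A #= [set: W]) -> laver_at T x l -> laver F T.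
Proof.
move=> FW [tT Tx Tagree TF]; have compat t : T t -> compatible (restrict x l) t.
  rewrite -(restrict_extend (x l) t) => Tt; case: (leP l (len t)) => [lt|/ltW tl].
    by apply/compatible_restrict => // c cl; apply/esym/(Tagree _ _ _ Tt) => //;
      apply: lt_le_trans lt.
  have : compatible (restrict (extend (x l) t) (len t)) (restrict x l).
    by apply/compatible_restrict => // c cl; apply: (Tagree _ _ _ Tt) => //;
      apply: lt_le_trans tl.
  by case; [right|left].
split=> //; exists (restrict x l); first split=> //; last first.
  move=> t; rewrite -(restrict_extend (x l) t) => Tt /sub_restrict[lt _].
  exact: TF.
move=> s'; rewrite -(restrict_extend (x l) s') => /=.
set y := extend _ _ => Ts' s'compat; rewrite leNgt; apply/negP => ls'.
have Tyl : T (restrict y l) by apply: tree_restrict Ts' => //; exact: ltW.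
(* A set of size omega_1 has an element above [y l]. The corresponding successor disagrees with [y]
   at [l], so a candidate stem longer than [l] is not compatible with it. *)
have [v /(succP W1) Tv] := unbounded_uncountable W1 (FW _ (TF _ _ Tyl (lexx l))) (y l).
move=> /lt_eqF/eqP; apply.
have [ss|/ltW ss] := leP (len s') (suc l).
  have := s'compat _ Tv; move/(compatible_restrict _ _ ss) => /(_ _ ls').
  by rewrite updE.
have : compatible (restrict (upd y l v) (suc l)) (restrict y (len s')).
  by have [] := s'compat _ Tv; [right|left].
by move/(compatible_restrict _ _ ss) => /(_ l (lt_suc W1 l)); rewrite updE.
Qed.

Lemma laver_laver_at T : laver F T -> exists x l, laver_at T x l.
Proof.
move=> [tT [s [Ts scompat _] TF]]; have [w0] := inhabited_omega1 W1.
rewrite -(restrict_extend w0 s) in Ts scompat TF.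
exists (extend w0 s), (len s); split=> // [y a c Ty ca cs|y a Ty sa].
  case: (leP (len s) a) => [sa|/ltW sa]; have := scompat _ Ty.
    by move/(compatible_restrict _ _ sa) => /(_ c cs).
  move=> H; have {H} : compatible (restrict y a) (restrict (extend w0 s) (len s)).
    by case: H; [right|left].
  by move/(compatible_restrict _ _ sa) => /(_ c ca).
apply: (TF _ Ty); have := scompat _ Ty; move/(compatible_restrict _ _ sa) => H.
by apply/sub_restrict.
Qed.

Definition laver_tree x l (A : node W W -> set W) : set (node W W) :=
  tree_of (fun t v => if len t < l then v = x (len t) else A t v).

Lemma laver_treeP x l A y a : laver_tree x l A (restrict y a) <->
  forall c, c < a -> if c < l then y c = x c else A (restrict y c) (y c).
Proof. exact: tree_ofP. Qed.

Lemma laver_tree_at x l A : (forall t, F (A t)) -> laver_at (laver_tree x l A) x l.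
Proof.
move=> FA; split=> [|||y a Ty la]; first exact: is_tree_tree_of.
- by apply/laver_treeP => c ->.
- by move=> y a c /laver_treeP H /H; case: ifP.
suff -> : succ (restrict y a) (laver_tree x l A) = A (restrict y a) by [].
have updK v c : c <= a -> restrict (upd y a v) c = restrict y c.
  by move=> ca; apply/restrict_eq/(agree_le ca)/upd_agree.
apply/seteqP; split=> v.
  move=> /(succP W1)/laver_treeP/(_ a (lt_suc W1 a)).
  by rewrite updE updK// ltNge la.
move=> Av; apply/(succP W1)/laver_treeP => c; rewrite ltS le_eqVlt.
case/orP => [/eqP ->|ca].   by rewrite updE updK// ltNge la.
rewrite updK ?(ltW ca)// (@upd_agree _ _ _ y a v c)//.
exact: (laver_treeP _ _ _ _ _).1 Ty _ ca.
Qed.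

Lemma laver_at_agree T x l y a :
  laver_at T x l -> T (restrict y a) -> l <= a -> agree l y x.
Proof. by case=> _ _ H _ Ty la c cl; apply: (H _ _ _ Ty) => //; apply: lt_le_trans la. Qed.

Context (FW : forall A, F A -> A #= [set: W]) (Fc : lt_omega1_closed (laver F)).

(** Each [A b] is turned into the tree with empty stem whose successor sets all equal [A b]. A lower
    bound of these trees has, at its stem, a successor set in [F] contained in every [A b]. *)
Lemma succ_sets_closed a (A : W -> set W) :
  (forall b, b < a -> F (A b)) ->
  (forall b c, b <= c -> c < a -> A c `<=` A b) ->
  exists2 B, F B & forall b, b < a -> B `<=` A b.
Proof.
move=> FA decA; have [w0] := inhabited_omega1 W1.
have [z _ zmin] := @min_exists _ _ W1 (fun=> True) (ex_intro _ w0 I).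
have z0 c : (c < z) = false by apply/negbTE; rewrite -leNgt; apply: zmin.
pose p b := laver_tree id z (fun=> if b < a then A b else A w0).
have pE b y c : b < a -> p b (restrict y c) <-> forall i, i < c -> A b (y i).
  by move=> ba; split=> [/laver_treeP H i /H|H]; last (apply/laver_treeP => i /H);
    rewrite z0 ba.
have pP b : b < a -> laver F (p b).
  move=> ba; apply: laver_at_laver => //; apply: laver_tree_at => t.
  by rewrite ba; apply: FA.
have [|b c bc ca|q /laver_laver_at[x [l qxl]] qp] := Fc (a := a) (p := p).
- exact: pP.
- move=> t; rewrite -(restrict_extend w0 t) => /(pE _ _ _ ca) H.
  apply/pE; first exact: le_lt_trans bc ca.
  by move=> i /H; exact: (decA _ _ bc ca).
- exists (succ (restrict x l) q) => [|b ba v /(succP W1)/(qp b ba)/(pE _ _ _ ba)].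
    by case: qxl => _ qx _; apply.
  by move=> /(_ l (lt_suc W1 l)); rewrite updE.
Qed.

(** Closure of the forcing alone does not control the stem of a lower bound. Here the tree is
    rebuilt with stem [restrict x l], taking at each later node a member of [F] inside all the
    successor sets. *)
Lemma pure_lower_bound a (T : W -> set (node W W)) (xs : W -> W -> W) (ls : W -> W) x l :
  (exists b, b < a) ->
  (forall b, b < a -> laver_at (T b) (xs b) (ls b)) ->
  (forall b c, b <= c -> c < a -> T c `<=` T b) ->
  (forall b, b < a -> T b (restrict x l) /\ ls b <= l) ->
  exists2 Q, laver_at Q x l & forall b, b < a -> Q `<=` T b.
Proof.
move=> [b0 b0a] lT decT Txl.
have FTb b y c : b < a -> T b (restrict y c) -> l <= c -> F (succ (restrict y c) (T b)).
  move=> ba Ty lc; have [_ _ _] := lT b ba; apply => //.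
  exact: le_trans (Txl b ba).2 lc.
have /choice[A AP] : forall t, exists B, F B /\
    (l <= len t -> (forall b, b < a -> T b t) -> forall b, b < a -> B `<=` succ t (T b)).
  move=> t; rewrite -(restrict_extend l t).
  set y := extend l t; set c := len t.
  have [[lc Ty]|nT] := pselect (l <= c /\ forall b, b < a -> T b (restrict y c)); last first.
    (* [laver_tree] wants a member of [F] at every node, also at irrelevant ones; nonemptiness of
       the sequence provides [b0] and hence this default. *)
    exists (succ (restrict x l) (T b0)); split; last by move=> lc Ty; case: nT.
    by apply: FTb => //; apply: (Txl _ b0a).1.
  have [|b b' bb' b'a|B FB BT] := @succ_sets_closed a (fun b => succ (restrict y c) (T b)).
  - by move=> b ba; apply: FTb => //; apply: Ty.
  - by move=> v /(succP W1) H; apply/(succP W1)/(decT _ _ bb').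
  - by exists B.
exists (laver_tree x l A); first by apply: laver_tree_at => t; exact: (AP t).1.
suff H y c : laver_tree x l A (restrict y c) -> forall b, b < a -> T b (restrict y c).
  by move=> b ba t; rewrite -(restrict_extend l t) => /H; exact.
move=> /laver_treeP; elim/(lt_ind W1): c => c IH Ay b ba.
have tT b' : b' < a -> is_tree (T b') by move=> /lT[].
apply: (@tree_limit _ _ W1 _ (T b) y c) => [|c' c'c]; first exact: tT.
have IHc b' : b' < a -> T b' (restrict y c').
  by move=> b'a; apply: IH => // i ic'; apply: Ay; apply: lt_trans c'c.
have [lc'|c'l] := leP l c'.
  have := Ay _ c'c; rewrite ltNge lc' /= => /((AP (restrict y c')).2 lc' IHc b ba).
  move/(succP W1); apply: tree_agree; apply/agree_suc; rewrite updE.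
  by split=> //; exact: upd_agree.
have [Tx _] := Txl b ba; apply: (@tree_agree _ _ _ _ x).
  move=> i; rewrite ltS => ic'; have := Ay i (le_lt_trans ic' c'c).
  by rewrite (le_lt_trans ic' c'l).
by apply: tree_restrict Tx; rewrite ?suc_le//; exact: tT.
Qed.

(** A constant nonempty sequence in [pure_lower_bound] moves the stem up to any node of the tree
    above it. *)
Lemma subtree_at T x l y a : laver_at T x l -> T (restrict y a) -> l <= a ->
  exists2 Q, laver_at Q y a & Q `<=` T.
Proof.
move=> lT Ty la; have [w0] := inhabited_omega1 W1.
have [| | | |Q lQ QT] := @pure_lower_bound (suc w0) (fun=> T) (fun=> x) (fun=> l) y a.
- by exists w0; exact: lt_suc.
- by [].
- by move=> b c _ _ t.
- by [].
- by exists Q => //; apply: (QT w0); exact: lt_suc.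
Qed.

(** Follow the stem, then pick any successor: successor sets have size omega_1, hence are nonempty,
    and limits stay in [T] by tree closure. *)
Lemma branch_through T x l : laver_at T x l ->
  exists2 y, branches T y & agree l y x.
Proof.
move=> [tT Tx _ TF]; have [w0] := inhabited_omega1 W1.
pose R c (h : W -> W) v := if c < l then v = x c else
  T (restrict h c) -> succ (restrict h c) T v.
have RT c h : (forall b, b < c -> R b h (h b)) -> T (restrict h c).
  move=> Rh; apply: (@tree_step _ _ W1 _ T h c) => // b bc Thb.
  have := Rh b bc; rewrite /R.
  case: ifP => [bl|_ /(_ Thb)/(succP W1)].
    move=> _; apply: (tree_agree _ (tree_restrict tT _ Tx)); last by rewrite suc_le.
    move=> i; rewrite ltS => ib; have := Rh i (le_lt_trans ib bc).
    by rewrite /R (le_lt_trans ib bl).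
  apply: tree_agree; apply/agree_suc; rewrite updE; split=> //; exact: upd_agree.
have [c h h' v hh'|c h Rh|y yP] := @wf_choice _ _ W1 W w0 R.
- suff E : restrict h c = restrict h' c by rewrite /R E.
  exact/restrict_eq.
- have [cl|lc] := ltP c l; first by exists (x c); rewrite /R cl.
  have := FW (TF _ _ (RT c h Rh) lc).
  move/(unbounded_uncountable W1)/(_ w0) => [v Tv _]; exists v.
  by rewrite /R ltNge lc.
- exists y => [c|c cl]; first exact: RT.
  by have := yP c; rewrite /R cl.
Qed.

End Laver.

(** * The map adding a Cohen real *)

Section CohenMap.
Context (d : Order.disp_t) (W : orderType d) (W1 : is_omega1 W).
Context (F : set (set W)) (FW : forall A, F A -> A #= [set: W]).
Context (col : (nat -> W) -> bool) (colP : forall G : seq W -> set W,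
  (forall q a, exists2 b, G q b & a < b) ->
  forall i, exists z, (forall n, G (mkseq z n) (z n)) /\ col z = i).
Context (e : W -> W)
  (eP : forall b a, e b <= a <-> forall c, c < b -> add_omega W1 (e c) <= a).
Context (s : node W bool).
Implicit Types (a b c g l : W) (x y : W -> W) (T : set (node W W)).
Local Notation suc := (suc W1).
Local Notation add_omega := (add_omega W1).
Local Notation restrict := Defs.restrict.

Lemma add_omega_mul b a : b < a -> add_omega (e b) <= e a.
Proof. by move=> ba; apply: (eP a _).1. Qed.

Lemma omega_mul_lt b a : b < a -> e b < e a.
Proof. by move=> /add_omega_mul; apply: lt_le_trans; apply: lt_add_omega. Qed.

Lemma omega_mul_le b a : (e b <= e a) = (b <= a).
Proof.
apply/idP/idP; first by apply: contraLR; rewrite -!ltNge => /omega_mul_lt.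
by rewrite le_eqVlt => /orP[/eqP ->//|/omega_mul_lt/ltW].
Qed.

Lemma le_omega_mul a : a <= e a.
Proof.
elim/(lt_ind W1): a => a IH; rewrite leNgt; apply/negP => ea.
by have := IH _ ea; rewrite leNgt omega_mul_lt.
Qed.

Lemma lt_omega_mulP c a : c < e a -> exists2 b, b < a & c < add_omega (e b).
Proof.
move=> ca; apply: contrapT => nb; move: ca; rewrite ltNge => /negP; apply.
apply/eP => b ba; rewrite leNgt; apply/negP => cb; apply: nb.
by exists b.
Qed.

Definition block x a : nat -> W := fun n => x (iter n suc a).

(** The values below [len s] are copied from [s], so the range lies in [basic_open s]; this
    localizes the argument to an arbitrary cone. Beyond [len s], the value at [b] is the colour of
    the [b]-th block of length omega. *)
Definition cohen_map (x : kreal W W) : kreal W bool :=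
  fun b => if s b is Some v then v else col (block x (e b)).

Lemma block_agree a x y : agree (add_omega a) x y -> block x a = block y a.
Proof. by move=> xy; apply/funext => n; apply: xy; apply: iter_lt_add_omega. Qed.

Lemma cohen_map_agree g x y :
  agree (e g) x y -> agree g (cohen_map x) (cohen_map y).
Proof.
move=> xy b bg; rewrite /cohen_map (@block_agree _ x y)//.
exact: agree_le (add_omega_mul bg) xy.
Qed.

(** The colouring property is applied to the successor sets of [T] along finite words appended to
    [restrict y a]; tree closure then adds the node of length [add_omega a]. *)
Lemma coloured_block T x l y a i :
  laver_at F T x l -> T (restrict y a) -> l <= a ->
  exists2 y', agree a y' y & T (restrict y' (add_omega a)) /\ col (block y' a) = i.
Proof.
move=> [tT _ _ TF] Ty la; have [w0] := inhabited_omega1 W1.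
have /choice[put putP] : forall z : nat -> W, exists y',
    agree a y' y /\ forall n, y' (iter n suc a) = z n.
  move=> z; have /choice[y' y'P] : forall c, exists v,
      (c < a -> v = y c) /\ forall n, c = iter n suc a -> v = z n.
    move=> c; have [ca|ac] := ltP c a.
      exists (y c); split=> // n cn; move: ca; rewrite cn ltNge.
      by case: n {cn} => [|n]; rewrite ?lexx// ltW// (lt_iter _ _ (ltn0Sn n)).
    have [[n cn]|nn] := pselect (exists n, c = iter n suc a).
      by exists (z n); split=> // m; rewrite cn => /iter_inj ->.
    by exists w0; split=> // n cn; case: nn; exists n.
  by exists y'; split=> [c|n]; [exact: (y'P c).1|exact: (y'P _).2].
(* This is the node of length [a] given by [y], followed by the word [q]. *)
pose pr q := restrict (put (nth w0 q)) (iter (size q) suc a).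
have laiter n : l <= iter n suc a.
  by apply: le_trans la _; case: n => // n; exact/ltW/(lt_iter W1 a (ltn0Sn n)).
(* The implication makes every letter admissible after a word that has left [T], so unboundedness
   holds at all words. *)
have [q b|z [zG zi]] := @colP (fun q v => T (pr q) -> succ (pr q) T v) _ i.
  have [Tq|nTq] := pselect (T (pr q)).
    have [v Tv bv] := unbounded_uncountable W1 (FW (TF _ _ Tq (laiter _))) b.
    by exists v.
  by exists (suc b); rewrite ?lt_suc.
have [zy zn] := putP z; exists (put z) => //.
have Tz n : T (restrict (put z) (iter n suc a)).
  elim: n => [|n IH]; first exact: tree_agree (agree_sym zy) Ty.
  have E : agree (iter n suc a) (put (nth w0 (mkseq z n))) (put z).
    have [py pn] := putP (nth w0 (mkseq z n)).
    move=> c cn; have [ca|ac] := ltP c a; first by rewrite py// zy.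
    have [m cm] := lt_add_omega_iter ac (lt_trans cn (iter_lt_add_omega W1 a n)).
    rewrite cm pn zn nth_mkseq//; case: (ltnP m n) => //.
    rewrite leq_eqVlt => /orP[/eqP nm|/(lt_iter W1 a)].
      by rewrite cm nm ltxx in cn.
    by rewrite -cm ltNge ltW.
  have := zG n; rewrite /pr size_mkseq => /(_ (tree_agree (agree_sym E) IH)).
  move/(succP W1); apply: tree_agree; apply/agree_suc; rewrite updE zn; split=> //.
  exact: agree_trans (upd_agree _ _) E.
split.
  apply: (@tree_limit _ _ W1 _ T) => // b /lt_add_omegaP[n bn].
  by apply: tree_restrict (Tz n); rewrite ?suc_le.
by rewrite -zi; congr col; apply/funext => n; rewrite /block zn.
Qed.

(** Blocks from [g] on lie above the stem and, as [len s] is at most [g], their colours are the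
    values of the map. They are coloured according to [u] one after another. *)
Lemma cohen_map_onto T x g (u : W -> bool) :
  laver_at F T x (e g) -> len s <= g -> agree g u (cohen_map x) ->
  exists y, [/\ branches T y, agree (e g) y x & cohen_map y = u].
Proof.
move=> lT sg ux; have [tT Tx _ _] := lT; have [w0] := inhabited_omega1 W1.
(* The approximation [v] counts up to the end of the [b]-th block. Below [g] it is read off from
   [x]; from [g] on its last block is coloured by [u b]. *)
pose R b (h : W -> W -> W) v := [/\ T (restrict v (add_omega (e b))),
  forall b', b' < b -> agree (add_omega (e b')) v (h b'),
  forall c, c < e g -> c < add_omega (e b) -> v c = x c
  & g <= b -> col (block v (e b)) = u b].
have [b h h' v hh' [Tv vh vx vu]|b h Rh|h hP] := @wf_choice _ _ W1 (W -> W) x R.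
- by split=> // b' b'b; rewrite -hh'//; exact: vh.
- have [bg|gb] := ltP b g.
    exists x; split=> //.
    + exact: tree_restrict (add_omega_mul bg) Tx.
    + move=> b' b'b c cb'; have [_ _ -> //] := Rh _ b'b.
      exact: lt_le_trans cb' (add_omega_mul (lt_trans b'b bg)).
    + by rewrite leNgt bg.
  have [b1 b2 b1b b2b|v vh] := coherent_union w0 (D := fun b' => b' < b) (h := h)
    (l := fun b' => add_omega (e b')).
    rewrite le_eqVlt => /orP[/eqP ->//|b12].
    by have [_ /(_ _ b12)/agree_sym ? _ _] := Rh _ b2b.
  have Tv : T (restrict v (e b)).
    apply: (@tree_limit _ _ W1 _ T) => // c /lt_omega_mulP[b' b'b cb'].
    have [Th _ _ _] := Rh _ b'b.
    apply: (@tree_agree _ _ _ _ (h b')).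
      apply: agree_sym; apply: agree_le (vh _ b'b); exact/ltW/suc_lt_add_omega.
    by apply: tree_restrict Th => //; exact/ltW/suc_lt_add_omega.
  have vx c : c < e g -> v c = x c.
    move=> cg; have /lt_omega_mulP[b' b'b cb'] : c < e b.
      by apply: lt_le_trans cg _; rewrite omega_mul_le.
    by rewrite (vh b')//; have [_ _ ->] := Rh _ b'b.
  have [|y yv [Ty yu]] := coloured_block (u b) lT Tv; first by rewrite omega_mul_le.
  exists y; split=> // [b' b'b c cb'|c cg _].
    have cb := lt_le_trans cb' (add_omega_mul b'b).
    by rewrite yv// (vh b').
  by rewrite yv ?vx//; apply: lt_le_trans cg _; rewrite omega_mul_le.
have hT b : T (restrict (h b) (add_omega (e b))) by case: (hP b).
have [b1 b2 _ _|y yh] := coherent_union w0 (D := fun=> True) (h := h)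
    (l := fun b => add_omega (e b)).
  rewrite le_eqVlt => /orP[/eqP ->//|b12].
  by have [_ /(_ _ b12)/agree_sym ? _ _] := hP b2.
have lt_add_mul b : b < add_omega (e b).
  by apply: le_lt_trans (le_omega_mul b) (lt_add_omega W1 _).
have yx : agree (e g) y x.
  by move=> c cg; rewrite (yh c)//; have [_ _ ->] := hP c.
exists y; split=> //.
  move=> a; apply: (@tree_agree _ _ _ _ (h a)); last first.
    by apply: tree_restrict (hT a) => //; exact: ltW.
  by apply: agree_sym; apply: agree_le (yh a I); exact: ltW.
apply/funext => b; have [bg|gb] := ltP b g.
  by rewrite (cohen_map_agree yx)// ux.
have sb : s b = None.
  by have := node_domE s b; rewrite ltNge (le_trans sg gb); case: (s b).
rewrite /cohen_map sb (block_agree (yh b I)).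
by have [_ _ _ ->] := hP b.
Qed.

End CohenMap.

(** * Topology *)

Section Topology.
Context (d : Order.disp_t) (W : orderType d) (W1 : is_omega1 W).
Local Notation restrict := Defs.restrict.

Lemma basic_open_open (L : Type) (s : node W L) : open (basic_open s).
Proof.
exists [set basic_open s]; last by rewrite bigcup_set1.
by move=> _ ->; apply: finI_from1; exists s.
Qed.

(** A finite intersection of subbasic sets around [x] depends only on [x] below a bound of their
    lengths, so the sets [basic_open] form a base. *)
Lemma kreal_openP (L : Type) (O : set (kreal W L)) :
  open O <-> forall x, O x -> exists a : W, forall y, agree a x y -> O y.
Proof.
split=> [[D subD <-] x [B DB xB]|H].
  have [fs fsD BE] := subD _ DB.
  have [w0] := inhabited_omega1 W1.
  have /choice[g gP] : forall A : set (kreal W L), exists a : W,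
      A \in fs -> forall y, agree a x y -> A y.
    move=> A; have [Afs|nA] := boolP (A \in fs); last by exists w0.
    have := fsD _ Afs; rewrite inE => -[t _ tA]; exists (len t) => _ y xy.
    move: xB; rewrite /= -BE => /(_ A Afs); rewrite -tA => xt b v tv.
    rewrite -xy; first exact: xt.
    by rewrite -node_domE tv.
  have [a aP] := countable_bounded W1 g (countable_fset fs).
  exists a => y xy; exists B => //=; rewrite -BE => A Afs.
  by apply: (gP A Afs); apply: agree_le xy; exact/ltW/aP.
have -> : O = \bigcup_(t in [set t | basic_open t `<=` O]) basic_open t.
  apply/seteqP; split=> [x Ox|x [t tO]]; last exact: tO.
  have [a aP] := H x Ox; exists (restrict x a); last exact/basic_open_restrict.
  by move=> y /basic_open_restrict; exact: aP.
by apply: bigcup_open => t _; exact: basic_open_open.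
Qed.

Lemma sigma11_preimage (L M : Type) :
  closed_under_preimages (@sigma11 _ W L) (@sigma11 _ W M).
Proof.
move=> f cf _ [C clC ->]; pose g (p : kreal W L * kreal W W) := (f p.1, p.2).
exists (g @^-1` C).
  apply: preimage_closed clC => p _ B [[A1 A2] /= [n1 n2] subB].
  exists (f @^-1` A1, A2); first by split=> //; exact: cf.
  by move=> q [q1 q2]; apply: (subB (g q)).
apply/seteqP; split=> [x [[y w] Cyw /= yx]|x [[y w] Cyw <-]].
  by exists (x, w); rewrite // /g /= -yx.
by exists (f y, w).
Qed.

Lemma sigma11_closedI (L : Type) : closed_under_closedI (@sigma11 _ W L).
Proof.
move=> _ D [C clC ->] clD; exists (C `&` fst @^-1` D).
  by apply: closedI => //; apply: preimage_closed clD => p _ B nB;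
    exists (B, setT); [split=> //; exact: filterT|move=> q []].
apply/seteqP; split=> [x [[[y w] Cyw yx] Dx]|x [[y w] [Cyw Dy] <-]].
  by exists (y, w) => //; split=> //; move: Dx; rewrite -yx.
by split=> //; exists (y, w).
Qed.

Lemma meager_indexed (L : Type) (P : set (set (node W L))) X :
  P_meager P X <-> exists A : W -> set (kreal W L),
    (forall a, P_nowhere_dense P (A a)) /\ X `<=` \bigcup_a A a.
Proof.
split=> [[N [NW Nnd XN]]|[A [And XA]]]; last first.
  exists (range A); split=> [|_ [a _ <-]//|x /XA[a _ Aax]]; first exact: card_image_le.
  by exists (A a).
have /pcard_surjP[g gN] := NW.
(* Indices whose image under [g] is outside [N] contribute the empty set. *)
exists (fun a => [set x | N (g a) /\ g a x]); split=> [a T PT|x /XN[B NB Bx]].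
  have [Nga|nN] := pselect (N (g a)).
    have [T' [PT' TT' H]] := Nnd _ Nga T PT.
    by exists T'; split=> // x /H ngx [].
  by exists T; split=> // x _ [].
by have [a _ ga] := gN _ NB; exists a => //=; rewrite ga.
Qed.

End Topology.

(** * Meager sets *)

Section Cohen.
Context (d : Order.disp_t) (W : orderType d).
Implicit Types (a b c : W) (x y z : W -> bool).
Local Notation restrict := Defs.restrict.

Lemma branches_cone (s : node W bool) :
  branches [set t | compatible s t] = basic_open s.
Proof.
rewrite -(restrict_extend true s); set y := extend _ _; set a := len s.
apply/seteqP; split=> x.
  by move=> /(_ a)/(compatible_restrict _ _ (lexx a)) ?; apply/basic_open_restrict.
move=> /basic_open_restrict yx b; case: (leP a b) => [ab|/ltW ba].
  exact/compatible_restrict.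
right; apply/sub_restrict; split=> //; exact/agree_sym/(agree_le ba).
Qed.

Lemma cone_sub x a y b : a <= b -> agree a x y ->
  [set t | compatible (restrict y b) t] `<=` [set t | compatible (restrict x a) t].
Proof.
move=> ab xy t /=; rewrite -(restrict_extend true t).
set z := extend _ _; set c := len t; have [bc|/ltW cb] := leP b c.
  move=> /(compatible_restrict _ _ bc) yz; apply/compatible_restrict.
    exact: le_trans bc.
  exact: agree_trans xy (agree_le ab yz).
move=> yz; have {}yz : agree c y z.
  by apply/agree_sym/(compatible_restrict _ _ cb); case: yz; [right|left].
have [ac|/ltW ca] := leP a c.
  by apply/compatible_restrict => //; apply: agree_trans xy (agree_le ac yz).
right; apply/sub_restrict; split=> //.
exact: agree_sym (agree_trans (agree_le ca xy) yz).
Qed.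

Lemma cohen_nowhere_denseP (A : set (kreal W bool)) :
  P_nowhere_dense (@cohen d W) A <->
  forall x a, exists y b, [/\ a <= b, agree a x y &
    forall z, agree b y z -> ~ A z].
Proof.
split=> [nd x a|H T [s ->]].
  have [_ [[t ->] ts tA]] := nd _ (ex_intro _ (restrict x a) erefl).
  rewrite branches_cone -(restrict_extend true t) in ts tA.
  set y := extend _ _ in ts tA; set b := len t in ts tA.
  have {}tA z : agree b y z -> ~ A z by move/basic_open_restrict/tA.
  have /= := ts (restrict y b) (or_introl (fun _ _ => id)).
  (* If [t] is shorter than [a], it is an initial segment of [x], and then [x] and [a] themselves
     already work. *)
  have [ab|/ltW ba] := leP a b.
    by move/(compatible_restrict _ _ ab) => xy; exists y, b.
  move=> xy; have {}xy : agree b y x.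
    by apply/(compatible_restrict _ _ ba); case: xy; [right|left].
  by exists x, a; split=> // z /(agree_le ba)/(agree_trans xy)/tA.
have [y [b [sb sy yA]]] := H (extend true s) (len s).
exists [set t | compatible (restrict y b) t]; split; first by exists (restrict y b).
  rewrite -(restrict_extend true s); exact: cone_sub.
by rewrite branches_cone => z /basic_open_restrict/yA.
Qed.

Lemma baire_property_locally (X : set (kreal W bool)) :
  (forall s, exists2 u, sub_node s u &
    P_meager (@cohen d W) (basic_open u `&` X) \/
    P_meager (@cohen d W) (basic_open u `\` X)) ->
  baire_property X.
Proof.
move=> H _ [s ->]; have [u su uX] := H s.
exists [set t | compatible u t]; split; last by rewrite branches_cone.
  by exists u.
move: su; rewrite -(restrict_extend true s) -(restrict_extend true u).
by move=> /sub_restrict[]; apply: cone_sub.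
Qed.

End Cohen.

(** * The Banach-Mazur game played simultaneously on Laver trees and Cohen conditions *)

Section Transfer.
Context (d : Order.disp_t) (W : orderType d) (W1 : is_omega1 W).
Context (F : set (set W)) (FW : forall A, F A -> A #= [set: W])
  (Fc : lt_omega1_closed (laver F)).
Context (col : (nat -> W) -> bool) (colP : forall G : seq W -> set W,
  (forall q a, exists2 b, G q b & a < b) ->
  forall i, exists z, (forall n, G (mkseq z n) (z n)) /\ col z = i).
Context (e : W -> W)
  (eP : forall b a, e b <= a <-> forall c, c < b -> add_omega W1 (e c) <= a).
Context (en : W -> node W W) (enP : forall t, exists a, en a = t).
Context (s : node W bool).
Implicit Types (a b c l : W) (x z : W -> W) (y : W -> bool) (T : set (node W W)).
Local Notation suc := (suc W1).
Local Notation restrict := Defs.restrict.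
Local Notation f := (cohen_map W1 col e s).

(* A Laver tree with a stem of length [e ht], which decides the values of [f]
   below [ht]. *)
Record stage := Stage { tree : set (node W W); real : W -> W; ht : W }.
Implicit Types p q : stage.

Definition good p := laver_at F (tree p) (real p) (e (ht p)) /\ len s <= ht p.

Definition below q p := [/\ tree q `<=` tree p,
  agree (e (ht p)) (real q) (real p) & ht p <= ht q].

Definition consistent y p := agree (ht p) y (f (real p)).

Lemma stage_in_tree T x l a : laver_at F T x l ->
  exists q, [/\ good q, tree q `<=` T & a < ht q].
Proof.
move=> lT; have [y Ty yx] := branch_through W1 FW lT.
have lm b c : exists2 m, b <= m & c < m.
  case: (ltP c b) => [cb|bc]; first by exists b.
  by exists (suc c); rewrite ?lt_suc// ltW// (le_lt_trans bc)// lt_suc.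
have [m0 lm0 sm0] := lm l (len s); have [m m0m am] := lm m0 a.
have [Q lQ QT] := subtree_at W1 FW Fc lT (Ty (e m))
  (le_trans lm0 (le_trans m0m (le_omega_mul eP m))).
exists (Stage Q y m); split=> //; split=> //=.
exact: le_trans (ltW sm0) m0m.
Qed.

Lemma below_of_sub q p : good p -> good q -> tree q `<=` tree p ->
  ht p <= ht q -> below q p.
Proof.
move=> [lp _] [lq _] qp pq; split=> //; apply: (laver_at_agree lp (a := e (ht q)));
  last first.
  by rewrite (omega_mul_le eP).
by apply: qp; case: lq.
Qed.

(** One move of the game: enter the dense set [D] after first passing through the target node [t],
    when [t] is a legal one. Varying [t] makes the answers dense on the Cohen side. *)
Lemma stage_step (D : set (kreal W W)) p a t :
  P_open_dense (laver F) D -> good p -> exists q,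
    [/\ good q, below q p, branches (tree q) `<=` D, a < ht q &
      tree p t -> e (ht p) <= len t ->
      basic_open t (real q) /\ len t <= e (ht q)].
Proof.
move=> Dd gp.
have [Q [z [l [lQ Qp QE]]]] : exists Q z l, [/\ laver_at F Q z l, Q `<=` tree p &
    tree p t -> e (ht p) <= len t -> l = len t /\ restrict z l = t].
  have [pt|npt] := pselect (tree p t /\ e (ht p) <= len t); last first.
    exists (tree p), (real p), (e (ht p)); split; first by case: gp.
      by [].
    by move=> pt et; case: npt.
  have tE := restrict_extend (len t) t.
  have [|Q lQ Qp] := subtree_at W1 FW Fc gp.1 _ pt.2 (y := extend (len t) t).
    by rewrite tE; exact: pt.1.
  by exists Q, (extend (len t) t), (len t); split.
have [Q' [/(laver_laver_at W1)[z' [l' lQ']] Q'Q Q'D]] := Dd _ (laver_at_laver W1 FW lQ).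
pose m := Order.max (Order.max a (len t)) (ht p).
have [q [gq qQ' mq]] := stage_in_tree m lQ'.
move: mq; rewrite !gt_max => /andP[/andP[aq tq] pq].
have tq' : len t <= e (ht q) by apply: le_trans (le_omega_mul eP _); exact: ltW.
exists q; split=> //.
- by apply: below_of_sub => //; [move=> r /qQ'/Q'Q/Qp|exact: ltW].
- by move=> x qx; apply: Q'D => b; apply/qQ'/qx.
move=> pt et; split=> //; have [lE <-] := QE pt et; apply/basic_open_restrict.
apply/agree_sym/(laver_at_agree lQ (a := e (ht q))); last by rewrite lE.
by apply/Q'Q/qQ'; case: gq => -[].
Qed.

(** With [g] the supremum of the heights, the stems glue to a node of length [e g] in all the trees,
    and [pure_lower_bound] gives a tree with this stem. Consistency survives since each c < g is
    below an earlier height. *)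
Lemma stage_limit a (h : W -> stage) p0 : good p0 ->
  (forall b, b < a -> good (h b) /\ below (h b) p0) ->
  (forall b c, b < c -> c < a -> below (h c) (h b)) ->
  exists q, [/\ good q, below q p0, forall b, b < a -> below q (h b) &
    forall y, consistent y p0 -> (forall b, b < a -> consistent y (h b)) ->
    consistent y q].
Proof.
move=> gp0 gh hh.
(* At the beginning of the game there is nothing to glue, and [p0] itself is the limit. *)
have [[b0 b0a]|na] := pselect (exists b, b < a); last first.
  exists p0; split=> // [|b ba]; first exact: below_of_sub.
  by case: na; exists b.
have [g gP] := seg_lub W1 (fun b => ht (h b)) (omega1_segments W1 a).
have hg b : b < a -> ht (h b) <= g by exact: (gP g).1.
have lt_g c : c < g -> exists2 b, b < a & c < ht (h b).
  move=> cg; apply: contrapT => nb; move: cg; rewrite ltNge => /negP; apply.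
  apply/gP => b ba; rewrite leNgt; apply/negP => cb; apply: nb.
  by exists b.
have [b c ba ca bc|x xh] := coherent_union b0 (D := fun b => b < a)
    (h := fun b => real (h b)) (l := fun b => e (ht (h b))).
  move: bc; rewrite le_eqVlt => /orP[/eqP ->//|bc].
  by apply: agree_sym; case: (hh _ _ bc ca).
have decT b c : b <= c -> c < a -> tree (h c) `<=` tree (h b).
  by rewrite le_eqVlt => /orP[/eqP -> _ r //|bc ca]; case: (hh _ _ bc ca).
have hT b c : b < a -> c < a -> tree (h b) (restrict (real (h c)) (e (ht (h c)))).
  move=> ba ca; have [[[tb Tb _ _] _] _] := gh _ ba.
  have [[[tc Tc _ _] _] _] := gh _ ca.
  case: (leP b c) => [bc|cb]; first exact: (decT _ _ bc ca).
  have [_ bc cb'] := hh _ _ cb ba; apply: (tree_agree bc).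
  by apply: tree_restrict Tb => //; rewrite (omega_mul_le eP).
have Tx b : b < a -> tree (h b) (restrict x (e g)).
  move=> ba; have [[[tb _ _ _] _] _] := gh _ ba.
  apply: (@tree_limit _ _ W1 _ (tree (h b))) => // c.
  move=> /(lt_omega_mulP eP)[b' /lt_g[b'' b''a bb''] cb'].
  have scb : suc c <= e (ht (h b'')).
    by apply: le_trans (add_omega_mul eP bb''); exact/ltW/suc_lt_add_omega.
  apply: (@tree_agree _ _ _ _ (real (h b''))).
    by apply: agree_sym; apply: agree_le (xh _ b''a).
  exact: tree_restrict (hT _ _ ba b''a).
have [||||Q lQ QT] := @pure_lower_bound _ _ W1 F FW Fc a (fun b => tree (h b))
    (fun b => real (h b)) (fun b => e (ht (h b))) x (e g).
- by exists b0.
- by move=> b /gh[[]].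
- exact: decT.
- by move=> b ba; split; [exact: Tx|rewrite (omega_mul_le eP) hg].
pose q := Stage Q x g; have gq : good q.
  split=> //=; have [[_ sb] _] := gh _ b0a; exact: le_trans (hg _ b0a).
have qh b : b < a -> below q (h b).
  by move=> ba; split; [exact: QT|exact: xh|exact: hg].
exists q; split=> //.
  have [_ hp0] := gh _ b0a; apply: below_of_sub => //.
    by move=> r /(QT _ b0a); case: hp0 => + _ _; apply.
  by case: hp0 => _ _ /le_trans; apply; exact: hg.
move=> y _ yh c /lt_g[b ba cb]; rewrite (yh b ba _ cb); apply/esym.
have xb : agree (e (ht (h b))) x (real (h b)) by case: (qh b ba).
exact: (cohen_map_agree col eP s xb).
Qed.

(** A [y] consistent with [p] is the image of a branch [x] of its tree. An initial segment of [x]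
    longer than the given condition is some [en b]; the answer [q b] extends it, so its Cohen part
    refines the condition, and every point of that cone is consistent with [q b]. *)
Lemma stage_nowhere_dense p (q : W -> stage) : good p ->
  (forall b, [/\ good (q b), below (q b) p &
    tree p (en b) -> e (ht p) <= len (en b) ->
    basic_open (en b) (real (q b)) /\ len (en b) <= e (ht (q b))]) ->
  P_nowhere_dense (@cohen d W)
    [set y | consistent y p /\ forall b, ~ consistent y (q b)].
Proof.
move=> gp qP; apply/cohen_nowhere_denseP => w c.
have [[y [wy yp]]|ny] := pselect (exists y, agree c w y /\ consistent y p); last first.
  by exists w, c; split=> // z wz [zp _]; apply: ny; exists z.
have [x [px xp xy]] := cohen_map_onto FW colP eP gp.1 gp.2 yp.
pose m := Order.max c (ht p).
have [cm pm] : c <= m /\ ht p <= m by rewrite !le_max !lexx orbT.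
have [b bE] := enP (restrict x (e m)).
have [gq qp] := qP b; rewrite bE /= => /(_ (px _)).
rewrite (omega_mul_le eP) => /(_ pm)[/basic_open_restrict xq].
rewrite (omega_mul_le eP) => mq.
exists (f (real (q b))), (ht (q b)); split; first exact: le_trans mq.
  apply: agree_trans wy _; rewrite -xy; apply: agree_le cm _.
  exact: (cohen_map_agree col eP s).
by move=> z /agree_sym qz [_ /(_ b)]; apply.
Qed.

Theorem meager_transfer T (Y : set (kreal W bool)) : laver F T ->
  P_meager (laver F) (branches T `&` f @^-1` Y) ->
  exists2 u, sub_node s u & P_meager (@cohen d W) (basic_open u `&` Y).
Proof.
move=> /(laver_laver_at W1)[x0 [l0 lT]] /meager_indexed[A [Ad YA]].
have [w0] := inhabited_omega1 W1.
have [p0 [gp0 p0T _]] := stage_in_tree w0 lT.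
(* [S] answers a position, a dense set index and a target node; [Lm] below selects the limit of a
   run of earlier stages. *)
have /choice[S SP] : forall pat : stage * W * node W W, exists q,
    good pat.1.1 -> [/\ good q, below q pat.1.1, branches (tree q) `<=` ~` A pat.1.2,
      pat.1.2 < ht q & tree pat.1.1 pat.2 -> e (ht pat.1.1) <= len pat.2 ->
      basic_open pat.2 (real q) /\ len pat.2 <= e (ht q)].
  move=> [[p a] t]; have [gp|ngp] := pselect (good p); last by exists p.
  by have [q] := stage_step a t (Ad a) gp; exists q.
have /choice[Lm LmP] : forall ah : W * (W -> stage), exists q,
    (forall b, b < ah.1 -> good (ah.2 b) /\ below (ah.2 b) p0) ->
    (forall b c, b < c -> c < ah.1 -> below (ah.2 c) (ah.2 b)) ->
    [/\ good q, below q p0, forall b, b < ah.1 -> below q (ah.2 b) &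
    forall y, consistent y p0 -> (forall b, b < ah.1 -> consistent y (ah.2 b)) ->
    consistent y q].
  move=> [a h].
  have [gh|ngh] := pselect (forall b, b < a -> good (h b) /\ below (h b) p0);
    last first.
    by exists p0 => gh; case: ngh.
  have [hh|nhh] := pselect (forall b c, b < c -> c < a -> below (h c) (h b)); last first.
    by exists p0 => _ hh; case: nhh.
  by have [q] := stage_limit gp0 gh hh; exists q.
(* A function [z] codes a run: at step [a] the target is [en (z a)], the answer is [t z a], and
   [L z a] is the position just before it. *)
have /choice[t tE] := fun z : W -> W =>
  wf_rec W1 p0 (fun a h => S (Lm (a, h), a, en (z a))).
pose L z a := Lm (a, fun b => if b < a then t z b else p0).
have {}tE z a : t z a = S (L z a, a, en (z a)) by rewrite tE.
have LP z a : (forall b, b < a -> good (t z b) /\ below (t z b) p0) ->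
    (forall b c, b < c -> c < a -> below (t z c) (t z b)) ->
    [/\ good (L z a), below (L z a) p0, forall b, b < a -> below (L z a) (t z b) &
    forall y, consistent y p0 -> (forall b, b < a -> consistent y (t z b)) ->
    consistent y (L z a)].
  move=> gt bt.
  have [b /= ba|b c /= bc ca|gL L0 Lt Lc] :=
    LmP (a, fun b => if b < a then t z b else p0).
  - by rewrite ba; exact: gt.
  - by rewrite ca (lt_trans bc ca); exact: bt.
  - split=> // [b ba|y y0 yt]; first by have := Lt b ba; rewrite /= ba.
    by apply: Lc => // b /= ba; rewrite ba; exact: yt.
have below_trans p q r : below r q -> below q p -> below r p.
  move=> [rq qr lqr] [qp pq lpq]; split=> [x /rq/qp//| |]; last exact: le_trans lqr.
  by apply: agree_trans pq; apply: agree_le qr; rewrite (omega_mul_le eP).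
have tP z a : [/\ good (t z a), below (t z a) p0 &
    forall b, b < a -> below (t z a) (t z b)].
  elim/(lt_ind W1): a => a IH.
  have [|b c bc ca|gL L0 Lt _] := LP z a.
  - by move=> b /IH[].
  - by case: (IH c ca) => _ _; apply.
  have [gt bt _ _ _] := SP (L z a, a, en (z a)) gL; rewrite -tE in gt bt.
  by split=> // [|b ba]; [exact: below_trans L0|exact: below_trans (Lt b ba)].
have {}LP z a : [/\ good (L z a), below (L z a) p0 &
    forall y, consistent y p0 -> (forall b, b < a -> consistent y (t z b)) ->
    consistent y (L z a)].
  have [||gL L0 _ Lc] := LP z a; last by split.
  - by move=> b _; case: (tP z b).
  - by move=> b c bc _; case: (tP z c) => _ _; apply.
(* A position depends only on [z] below [a], so positions are coded by nodes, and [en] lists them in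
   type omega_1. *)
have Lext z z' a : agree a z z' -> L z a = L z' a.
  elim/(lt_ind W1): a => a IH zz'; rewrite /L; congr (Lm (a, _)).
  apply/funext => b; case: ifP => // ba.
  by rewrite !tE zz'// IH//; apply: agree_le zz'; exact: ltW.
(* [M a] collects the points consistent with the position coded by [en a] from which every next move
   loses consistency. *)
pose M a := [set y | consistent y (L (extend w0 (en a)) (len (en a))) /\
  forall b, ~ consistent y (S (L (extend w0 (en a)) (len (en a)), len (en a), en b))].
exists (restrict (f (real p0)) (ht p0)).
  move=> b v sb /=; have /lt_le_trans -> : b < len s by rewrite -node_domE sb.
    by rewrite /f sb.
  exact: gp0.2.
apply/meager_indexed; exists M; split=> [a|y [/basic_open_restrict/agree_sym y0 Yy]].
  have [gL _ _] := LP (extend w0 (en a)) (len (en a)).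
  by apply: stage_nowhere_dense => // b; have [? ? _ _ ?] := SP (_, len (en a), en b) gL.
(* A point [y] outside all the [M a] can be followed through a whole run. The glued real [x] is then
   a branch of [T] with image [y] that avoids every [A a], although [Y] contains [y]. *)
apply: contrapT => nM.
have [a z z' v zz'|a z Rz|z zP] := @wf_choice _ _ W1 W w0
    (fun a z v => consistent y (S (L z a, a, en v))).
- by rewrite (Lext _ _ _ zz').
- have [_ _ /(_ y y0)] := LP z a; have [b bE] := enP (restrict z a) => yL.
  apply: contrapT => nv; apply: nM; exists b => //; rewrite /M bE /=.
  have /Lext -> : agree a (extend w0 (restrict z a)) z.
    by apply/restrict_eq; exact: (restrict_extend w0 (restrict z a)).
  split=> [|b' yb']; last by apply: nv; exists b'.
  by apply: yL => b' b'a; rewrite tE; exact: Rz.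
have {}zP a : consistent y (t z a) by rewrite tE; exact: zP.
have ltt a : a < ht (t z a).
  by rewrite tE; have [gL _ _] := LP z a; case: (SP (L z a, a, en (z a)) gL).
have [b c _ _ bc|x xt] := coherent_union w0 (D := fun=> True)
    (h := fun a => real (t z a)) (l := fun a => e (ht (t z a))).
  move: bc; rewrite le_eqVlt => /orP[/eqP -> //|bc].
  by apply: agree_sym; case: (tP z c) => _ _ /(_ _ bc)[].
have xT a : branches (tree (t z a)) x.
  move=> c; pose m := Order.max a c.
  have [am cm] : a <= m /\ c <= m by rewrite !le_max !lexx orbT.
  have mT : tree (t z a) (restrict (real (t z m)) (e (ht (t z m)))).
    have [[[_ Tm _ _] _] _ bm] := tP z m.
    by move: am; rewrite le_eqVlt => /orP[/eqP ->//|/bm[+ _ _]]; apply.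
  have cem : c <= e (ht (t z m)).
    by apply: le_trans (le_omega_mul eP _); apply: le_trans cm _; exact: ltW.
  apply: (@tree_agree _ _ _ _ (real (t z m))).
    exact/agree_sym/(agree_le cem)/(xt m I).
  by apply: tree_restrict mT => //; case: (tP z a) => -[[]].
have fxy : f x = y.
  apply/funext => c; rewrite (zP c c (ltt c)).
  by apply: (cohen_map_agree col eP s (xt c I)); exact: ltt.
have [a _ Aax] : (\bigcup_a A a) x.
  apply: YA; split; last by rewrite /= fxy.
  by move=> c; apply: p0T; case: (tP z w0) => _ [+ _ _] _; apply; exact: xT.
have [gL _ _] := LP z a; have [_ _ /(_ x) + _ _] := SP (L z a, a, en (z a)) gL.
by rewrite -tE; apply => //; exact: xT.
Qed.


End Transfer.

(** * The club filter *)

Section ClubFilter.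
Context (d : Order.disp_t) (W : orderType d) (W1 : is_omega1 W).
Implicit Types (a b c : W) (w : W -> W) (y z : W -> bool).
Local Notation suc := (suc W1).
Local Notation restrict := Defs.restrict.

Definition closed_under w a := (exists b, b < a) /\ forall b, b < a -> w b < a.

(** The nonzero closure points of a function form a club, and every club contains all closure points
    of some function; so this is the usual club filter, with [w] as the witness. *)
Definition club_filter : set (kreal W bool) :=
  [set y | exists w, forall a, closed_under w a -> y a].

(** The matrix is closed: a failure at [a] is decided by [y] up to and including [a] and by [w]
    below [a]. *)
Lemma sigma11_club_filter : sigma11 club_filter.
Proof.
exists [set p : kreal W bool * kreal W W | forall a, closed_under p.2 a -> p.1 a];
    last first.
  apply/seteqP; split=> [y [w yw]|y [[y' w] /= yw <-]]; last by exists w.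
  by exists (y, w).
rewrite -openC openE => -[y w] /existsNP[a /not_implyP[/= [a0 aw] nya]].
exists (basic_open (restrict y (suc a)), basic_open (restrict w a)).
  by split; apply: open_nbhs_nbhs; split; try exact: basic_open_open;
    exact/basic_open_restrict.
move=> [y' w'] [/= /basic_open_restrict yy' /basic_open_restrict ww'] H.
apply: nya; rewrite yy' ?lt_suc//; apply: H; split=> //= b ba.
by rewrite -ww'//; exact: aw.
Qed.

(** Iterate omega times a function that bounds both [w] and [w'] on initial segments, and take the
    supremum. *)
Lemma common_closed_point w w' : exists a, closed_under w a /\ closed_under w' a.
Proof.
have [w0] := inhabited_omega1 W1.
have /choice[B BP] : forall a, exists v,
    a < v /\ forall b, b <= a -> w b < v /\ w' b < v.
  move=> a; have sega := omega1_segments W1 (suc a).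
  have [v vP] := countable_bounded W1 w sega.
  have [v' v'P] := countable_bounded W1 w' sega.
  exists (Order.max (suc a) (Order.max v v')).
  split=> [|b ba]; first by rewrite lt_max lt_suc.
  have ba' : b < suc a by rewrite ltS.
  by rewrite !lt_max (vP b ba') (v'P b ba') !orbT.
pose a := lub W1 (fun n => iter n B w0).
have ltB n : iter n B w0 < a.
  exact: lt_le_trans (BP _).1 (le_lub W1 (fun n => iter n B w0) n.+1).
have wa b : b < a -> w b < a /\ w' b < a.
  move=> ba; have [n bn] : exists n, b < iter n B w0.
    apply: contrapT => /forallNP nb; move: ba; rewrite ltNge => /negP; apply.
    by apply/lub_le => n; rewrite leNgt; exact/negP/nb.
  have [? ?] := (BP (iter n B w0)).2 b (ltW bn).
  by split; apply: lt_trans (ltB n.+1).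
exists a; split; split=> [|b /wa[]//]; exists w0; exact: (ltB 0%N).
Qed.

(* Along the construction of a point outside all the [A a], the value at the
   length of each proper approximation is prescribed to be [i]; these lengths
   form a club. *)
Lemma constant_on_club (A : W -> set (kreal W bool)) (s : node W bool) (i : bool) :
  (forall a, P_nowhere_dense (@cohen d W) (A a)) ->
  exists y, [/\ basic_open s y, forall a, ~ A a y &
    exists w, forall a, closed_under w a -> y a = i].
Proof.
move=> And; rewrite -(restrict_extend true s).
set y0 := extend _ _; set l0 := len s.
(* A pair is an approximation with its length. In the last clause [m] is the supremum of [l0] and
   the earlier lengths, the place where the value [i] is written. *)
pose R a (h : W -> (W -> bool) * W) (v : (W -> bool) * W) :=
  [/\ forall z, agree v.2 v.1 z -> ~ A a z,
      forall b, b < a -> agree (h b).2 v.1 (h b).1,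
      agree l0 v.1 y0 /\ l0 <= v.2 &
      forall m, (forall c, m <= c <-> l0 <= c /\ forall b, b < a -> (h b).2 <= c) ->
        v.1 m = i /\ m < v.2].
have seg a (h : W -> (W -> bool) * W) : exists m, forall c,
    m <= c <-> l0 <= c /\ forall b, b < a -> (h b).2 <= c.
  have [m mP] := seg_lub W1 (fun b => (h b).2) (omega1_segments W1 a).
  exists (Order.max l0 m) => c; rewrite ge_max; split=> [/andP[-> /mP]|[-> /mP]] //.
have [a h h' v hh' [vA vh v0 vm]|a h Rh|h hP] :=
  @wf_choice _ _ W1 ((W -> bool) * W) (y0, l0) R.
- split=> // [b ba|m mP]; first by rewrite -hh'//; exact: vh.
  apply: vm => c; rewrite mP; split=> -[lc H]; split=> // b ba;
    [rewrite hh'//|rewrite -hh'//]; exact: H.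
- have [m mP] := seg a h.
  have lm : l0 <= m by case: ((mP m).1 (lexx m)).
  have hm b : b < a -> (h b).2 <= m by case: ((mP m).1 (lexx m)) => _; apply.
  have [y1 [y1h y10]] : exists y1, (forall b, b < a -> agree (h b).2 y1 (h b).1) /\
      agree l0 y1 y0.
    have [[b0 b0a]|na] := pselect (exists b, b < a); last first.
      by exists y0; split=> // b ba; case: na; exists b.
    have [b c ba ca bc|y1 y1h] := coherent_union true (D := fun b => b < a)
        (h := fun b => (h b).1) (l := fun b => (h b).2).
      move: bc; rewrite le_eqVlt => /orP[/eqP ->//|bc].
      by apply: agree_sym; case: (Rh _ ca) => _ /(_ _ bc).
    exists y1; split=> //; have [_ _ [h0 lh] _] := Rh _ b0a.
    exact: agree_trans (agree_le lh (y1h _ b0a)) h0.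
  (* Nowhere density is used at length [suc m], after [i] has been placed at [m], so that the
     extension keeps this value. *)
  have [y2 [l2 [ml2 y12 y2A]]] :=
    (cohen_nowhere_denseP _).1 (And a) (upd y1 m i) (suc m).
  have y21 : agree m y2 y1.
    apply: (agree_trans _ (upd_agree y1 i)).
    by apply: agree_sym; apply: agree_le y12; exact/ltW/lt_suc.
  rewrite suc_le in ml2; exists (y2, l2); split=> //=.
  + by move=> b ba; apply: (agree_trans _ (y1h b ba)); apply: agree_le y21; exact: hm.
  + split; last exact: le_trans lm (ltW ml2).
    exact: (agree_trans (agree_le lm y21) y10).
  + move=> m' m'P; have -> : m' = m.
      by apply: le_anti; apply/andP; split; [apply/m'P/mP|apply/mP/m'P].
    by rewrite -y12 ?lt_suc ?updE.
have [b c _ _ bc|y yh] := coherent_union true (D := fun=> True)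
    (h := fun b => (h b).1) (l := fun b => (h b).2).
  move: bc; rewrite le_eqVlt => /orP[/eqP ->//|bc].
  by apply: agree_sym; case: (hP c) => _ /(_ _ bc).
have [w0] := inhabited_omega1 W1.
exists y; split.
- apply/basic_open_restrict/agree_sym; have [_ _ [h0 lh] _] := hP w0.
  exact: agree_trans (agree_le lh (yh _ I)) h0.
- by move=> a; have [hA _ _ _] := hP a; apply: hA; exact/agree_sym/yh.
have lt_h a : a < (h a).2.
  elim/(lt_ind W1): a => a IH; have [m mP] := seg a h.
  have [_ _ _ /(_ m mP)[_ mh]] := hP a; apply: le_lt_trans mh.
  rewrite leNgt; apply/negP => ma; have [_ /(_ _ ma)] := (mP m).1 (lexx m).
  by rewrite leNgt IH.
exists (fun b => (h b).2) => a [[b0 b0a] ha]; have [m mP] := seg a h.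
have [_ _ _ /(_ m mP)[hm mh]] := hP a.
(* A closure point of the lengths is their supremum: the lengths before [a] are below [a], and m < a
   is impossible since the length at [m] exceeds [m]. *)
have am : a = m.
  apply: le_anti; apply/andP; split; last first.
    apply/mP; split=> [|b /ha/ltW//]; have [_ _ [_ lh] _] := hP b0.
    exact: le_trans lh (ltW (ha _ b0a)).
  rewrite leNgt; apply/negP => ma; have [_ /(_ _ ma)] := (mP m).1 (lexx m).
  by rewrite leNgt lt_h.
by rewrite -hm -am; apply: (yh a I); exact: lt_h.
Qed.

(** In any cone, every meager set misses a point equal to true on a club and one equal to false on a
    club. The latter is outside the filter because two clubs meet. *)
Lemma club_filter_not_baire : ~ baire_property club_filter.
Proof.
have [w0] := inhabited_omega1 W1.
move=> /(_ _ (ex_intro _ (restrict (fun=> true) w0) erefl))[_ [[u ->] _]].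
rewrite branches_cone => -[|] /meager_indexed[A [And XA]].
  have [y [uy yA [w yw]]] := constant_on_club u true And.
  have [|a _ Aay] := XA y; last exact: yA Aay.
  by split=> //; exists w.
have [y [uy yA [w yw]]] := constant_on_club u false And.
have [|a _ Aay] := XA y; last exact: yA Aay.
split=> // -[w' yw']; have [a [aw aw']] := common_closed_point w w'.
by have := yw' a aw'; rewrite yw.
Qed.

End ClubFilter.

(** * From Laver measurability to the Baire property, and a non-measurable analytic set *)

Theorem proposition33 (d : Order.disp_t) (W : orderType d) (F : set (set W)) :
  is_omega1 W ->
  [set: node W W] #= [set: W] ->
  laver_version F ->
  (forall (G2 : set (set (kreal W bool))) (Gk : set (set (kreal W W))),
     topologically_reasonable G2 Gk ->
     (forall X, Gk X -> P_measurable (laver F) X) ->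
     forall X, G2 X -> baire_property X) /\
  (exists X : set (kreal W W), sigma11 X /\ ~ P_measurable (laver F) X).
Proof.
move=> W1 nodeW [FW Fc _].
have [col colP] := coloring W1.
have [e eP] := omega_mul_exists W1.
have [w0] := inhabited_omega1 W1.
(* The cardinality assumption gives an injection of the nodes into [W]; [en] is a left inverse of
   it, hence onto. *)
have [en enP] : exists en : W -> node W W, forall t, exists a, en a = t.
  have /card_eqP[g] := nodeW; pose h (t : node W W) := val (g (to_setT t)).
  have hinj : injective h.
    by move=> t t' /val_inj /inj H; have := H (in_setT _) (in_setT _) => /(congr1 val).
  have /choice[en enP] : forall a, exists t, forall t', h t' = a -> t' = t.
    move=> a; have [[t <-]|na] := pselect (exists t, h t = a).
      by exists t => t' /hinj.
    by exists (Defs.restrict id w0) => t' ht'; case: na; exists t'.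
  by exists en => t; exists (h t); rewrite -(enP _ t erefl).
(* A lower bound of the empty sequence is a first Laver tree. *)
have [T lT] : exists T, laver F T.
  have [z _ zmin] := min_exists W1 (ex_intro (fun=> True) w0 I).
  have [b|b c bz|q lq _] := Fc z (fun=> setT); last by exists q.
    by move=> bz; have := zmin b I; rewrite leNgt bz.
  by [].
have transfer G2 Gk : topologically_reasonable G2 Gk ->
    (forall X, Gk X -> P_measurable (laver F) X) ->
    forall X, G2 X -> baire_property X.
  move=> [[_ _ G2k _] _] Gm X G2X; apply: baire_property_locally => s.
  have cf : continuous (cohen_map W1 col e s : kreal W W -> kreal W bool).
    apply/continuousP => O /(kreal_openP W1) Oo; apply/(kreal_openP W1) => x /Oo[a aP].
    by exists (e a) => y xy; apply: aP; apply: cohen_map_agree.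
  have [T' [lT' _ [m|m]]] := Gm _ (G2k _ cf _ G2X) T lT.
    have [u su um] := meager_transfer FW Fc colP eP enP lT' m.
    by exists u => //; left.
  (* The preimage of the complement is the complement of the preimage, so the comeager case is the
     meager case for the complement of [X]. *)
  have [u su um] := meager_transfer (s := s) (Y := ~` X) FW Fc colP eP enP lT' m.
  by exists u => //; right.
split=> //; apply: contrapT => nX.
apply: (club_filter_not_baire W1).
apply: (transfer _ (@sigma11 _ W W)); last exact: sigma11_club_filter W1.
  split; last by split; exact: sigma11_closedI.
  by split; exact: sigma11_preimage.
by move=> X sX; apply: contrapT => nm; apply: nX; exists X.
Qed.
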